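(* Let $R$ be a ring and ${}'\mathcal{C}={}'\mathcal{C}_R$. The following statements are equivalent. 1. $Q_{l,\mathrm{cl}}(R)$ is a semisimple Artinian ring. 2. $R$ is a semiprime ring, $\mathrm{udim}({}_RR)<\infty$, the ring $R$ satisfies the a.c.c. on right annihilators, and ${}'\mathcal{C}_U\neq\emptyset$ for all uniform left ideals $U$ of $R$. 3. $R$ is a semiprime ring, $\mathrm{udim}({}_RR)<\infty$, the set $\{\ker(c_R\cdot)\mid c\in{}'\mathcal{C}\}$ satisfies the a.c.c., and ${}'\mathcal{C}_U\neq\emptyset$ for all uniform left ideals $U$ of $R$. 4. $R$ is a semiprime ring, $\mathrm{udim}({}_RR)<\infty$, the set $\{\ker(r_R\cdot)\mid r\in R\}$ satisfies the a.c.c., and ${}'\mathcal{C}_U\neq\emptyset$ for all uniform left ideals $U$ of $R$.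
   Context: Rings are associative with $1$. ${}'\mathcal{C}_R$ is the set of left regular elements of $R$: those $r\in R$ such that $xr=0$ ($x\in R$) implies $x=0$. $\mathcal{C}_R$ is the set of regular elements: those $r$ such that $xr=0$ implies $x=0$ and $rx=0$ implies $x=0$. For a left ideal $I$ of $R$, ${}'\mathcal{C}_I:=\{i\in I\mid I\to I,\ x\mapsto xi,\text{ is injective}\}$. For $r\in R$, $r_R\cdot:R\to R$ is the map $x\mapsto rx$, so $\ker(r_R\cdot)=\{x\in R\mid rx=0\}$. A right annihilator is a right ideal of the form $\{r\in R\mid Xr=0\}$ for a nonempty subset $X\subseteq R$. The a.c.c. refers to inclusion. $Q_{l,\mathrm{cl}}(R):=\mathcal{C}_R^{-1}R$ is the classical left quotient ring; it exists exactly when $\mathcal{C}_R$ is a left Ore set (i.e. $\mathcal{C}_Rr\cap Rc\neq\emptyset$ for all $r\in R$, $c\in\mathcal{C}_R$), and the assertion that it is semisimple Artinian includes the assertion that it exists. A nonzero module is uniform if any two of its nonzero submodules have nonzero intersection; a uniform left ideal is a left ideal that is uniform as a left module. $\mathrm{udim}({}_RR)<\infty$ means that there are finitely many uniform left ideals of $R$ whose sum is direct and is an essential left ideal of $R$. *)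

(* Defs.v *)
From HB Require Import structures.
From mathcomp Require Import all_boot all_order all_algebra.
From mathcomp Require Import boolp classical_sets.

Set Implicit Arguments.
Unset Strict Implicit.
Unset Printing Implicit Defensive.

Import GRing.Theory.
Local Open Scope classical_set_scope.
Local Open Scope ring_scope.

Section Ideals.
Variable R : pzRingType.
Implicit Types (I J U : set R) (r s x y : R).

(* R^o is R viewed as a left module over itself. *)
Definition left_ideal I : Prop := GRing.submod_closed ([in I] : {pred R^o}).

Definition two_sided_ideal I : Prop :=
  left_ideal I /\ (forall x r, I x -> I (x * r)).

(* \prod_(i < n) multiplies in increasing order of i, so this says I ^ n = 0. *)
Definition nilpotent_ideal I : Prop :=
  exists n, forall a : 'I_n -> R, (forall i, I (a i)) -> \prod_(i < n) a i = 0.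

Definition semiprime : Prop :=
  forall I, two_sided_ideal I -> nilpotent_ideal I -> I = [set 0].

Definition simple_left_ideal I : Prop :=
  [/\ left_ideal I, I != [set 0] &
      forall J, left_ideal J -> J `<=` I -> J = [set 0] \/ J = I].

Definition uniform_left_ideal U : Prop :=
  [/\ left_ideal U, U != [set 0] &
      forall I J, left_ideal I -> left_ideal J -> I `<=` U -> J `<=` U ->
        I != [set 0] -> J != [set 0] -> I `&` J != [set 0]].

Definition essential_left_ideal I : Prop :=
  left_ideal I /\
  forall J, left_ideal J -> J != [set 0] -> I `&` J != [set 0].

Definition ideal_sum n (L : 'I_n -> set R) : set R :=
  [set x | exists2 a : 'I_n -> R, (forall i, L i (a i)) & x = \sum_(i < n) a i].

Definition direct_ideal_sum n (L : 'I_n -> set R) : Prop :=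
  forall a : 'I_n -> R, (forall i, L i (a i)) -> \sum_(i < n) a i = 0 ->
    forall i, a i = 0.

Definition finite_left_udim : Prop :=
  exists n (L : 'I_n -> set R),
    [/\ forall i, uniform_left_ideal (L i), direct_ideal_sum L &
        essential_left_ideal (ideal_sum L)].

(* Ascending and descending chain conditions on a set F of subsets of R. *)
Definition acc_on (F : set (set R)) : Prop :=
  forall A : nat -> set R, (forall n, F (A n)) -> (forall n, A n `<=` A n.+1) ->
    exists N, forall n, (N <= n)%N -> A n = A N.

Definition dcc_on (F : set (set R)) : Prop :=
  forall A : nat -> set R, (forall n, F (A n)) -> (forall n, A n.+1 `<=` A n) ->
    exists N, forall n, (N <= n)%N -> A n = A N.

Definition left_artinian : Prop := dcc_on left_ideal.

(* The left module R is the sum of its simple submodules. *)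
Definition semisimple : Prop :=
  forall x, exists n (L : 'I_n -> set R),
    (forall i, simple_left_ideal (L i)) /\ ideal_sum L x.

Definition semisimple_artinian : Prop := semisimple /\ left_artinian.

(* Beware that the terminology differs from MathComp: a left regular element
   here, i.e. one with x * r = 0 -> x = 0, is a GRing.rreg element. *)
Definition left_regular : set R := [set r | forall x, x * r = 0 -> x = 0].

Definition regular : set R :=
  [set r | (forall x, x * r = 0 -> x = 0) /\ (forall x, r * x = 0 -> x = 0)].

Definition left_regular_in I : set R :=
  [set i | I i /\ {in I &, injective (fun x => x * i)}].

Definition ker_lmul r : set R := [set x | r * x = 0].

Definition right_annihilator (X : set R) : set R :=
  [set r | forall x, X x -> x * r = 0].

Definition right_annihilators : set (set R) :=
  [set right_annihilator X | X in [set X | X !=set0]].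

Definition is_inverse x y : Prop := x * y = 1 /\ y * x = 1.

End Ideals.

Arguments left_regular R : clear implicits.
Arguments regular R : clear implicits.
Arguments right_annihilators R : clear implicits.

(* f : R -> Q exhibits Q as the localization C_R^-1 R at the regular elements:
   f is injective, regular elements become units, and every element of Q is a
   left fraction (f c)^-1 * f r. Such a pair is unique up to a unique
   isomorphism over R, and exists iff C_R is a left Ore set. *)
Definition classical_left_quotient_ring (R Q : pzRingType)
    (f : {rmorphism R -> Q}) : Prop :=
  [/\ injective f,
      forall c, regular R c -> exists v, is_inverse (f c) v &
      forall q, exists c r v, [/\ regular R c, is_inverse (f c) v & q = v * f r]].

Definition has_semisimple_artinian_left_quotient_ring (R : pzRingType) : Prop :=
  exists (Q : pzRingType) (f : {rmorphism R -> Q}),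
    classical_left_quotient_ring f /\ semisimple_artinian Q.

(* Main.v *)
Require Import Defs.
From HB Require Import structures.
From mathcomp Require Import all_boot all_order all_algebra.
From mathcomp Require Import boolp classical_sets.

(** The theorem is a one-sided Goldie theorem; everything turns on the property
[essential_regular]: every essential left ideal of [R] contains a regular
element.

If [C^-1 R = Q] is semisimple Artinian, an essential left ideal [W] of [R]
generates a left ideal of [Q] that meets, hence contains, every simple left
ideal; so it is [Q], and clearing the denominator of [1] gives a regular element
of [W] ([semisimple_essential_regular]). Semiprimeness
([essential_regular_semiprime]) and the elements of [U] acting injectively on a
uniform [U] ([essential_regular_uniform]) follow from this property alone. The
chain condition on right annihilators comes from left annihilators in the
Artinian ring [Q], and the contractions to [R] of the simple summands of [Q] are
uniform, with a direct and essential sum.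

Conversely, assume the weakest chain condition, the one on kernels of left
regular elements. Finiteness of the uniform dimension is used through an
induction principle on left ideals, [finite_left_udim_ind]. It shows that an
essential left ideal contains a left regular element
([essential_left_regular]) and that a left regular [c] generates an essential
left ideal ([principal_left_regular_essential]). So the kernels of left regular
elements are directed, the chain condition makes one of them the largest, and
semiprimeness makes it zero ([left_regular_regular]): left regular elements are
regular, and [essential_regular] holds. The left Ore condition follows, the ring
of fractions [Q] is constructed, and if [U_1 + ... + U_n] is an essential sum of
uniform left ideals, then [Q] is the sum of the [Q U_i], which are simple
([simple_ext]). *)

Set Implicit Arguments.
Unset Strict Implicit.
Unset Printing Implicit Defensive.

Import GRing.Theory.
Local Open Scope classical_set_scope.
Local Open Scope ring_scope.

(** * Left ideals *)

Section LeftIdeals.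
Variable R : pzRingType.
Implicit Types (I J U V A : set R) (x y r c : R).

Lemma left_idealP I :
  left_ideal I <-> [/\ I 0, forall x y, I x -> I y -> I (x + y)
                        & forall r x, I x -> I (r * x)].
Proof.
split=> [[I0 Ilin]|[I0 Iadd Imul]].
  have I00 : I 0 by move: I0; rewrite inE.
  have lin a x y : I x -> I y -> I (a * x + y).
    by move=> Ix Iy; move: (Ilin a x y); rewrite !inE; apply.
  split=> // [x y Ix Iy|r x Ix]; first by rewrite -[x]mul1r; apply: lin.
  by rewrite -[r * x]addr0; apply: lin.
split; first by rewrite inE.
by move=> a x y; rewrite !inE => Ix Iy; apply: Iadd => //; apply: Imul.
Qed.

Lemma left_ideal0 I : left_ideal I -> I 0.
Proof. by case/left_idealP. Qed.

Lemma left_idealD I x y : left_ideal I -> I x -> I y -> I (x + y).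
Proof. by case/left_idealP=> _ + _; apply. Qed.

Lemma left_idealM I r x : left_ideal I -> I x -> I (r * x).
Proof. by case/left_idealP=> _ _; apply. Qed.

Lemma left_idealN I x : left_ideal I -> I x -> I (- x).
Proof. by move=> li Ix; rewrite -mulN1r; apply: left_idealM. Qed.

Lemma left_idealB I x y : left_ideal I -> I x -> I y -> I (x - y).
Proof. by move=> li Ix Iy; apply: left_idealD => //; apply: left_idealN. Qed.

Lemma left_ideal_sum I n (a : 'I_n -> R) :
  left_ideal I -> (forall i, I (a i)) -> I (\sum_(i < n) a i).
Proof.
move=> li Ia; apply: big_ind => //; first exact: left_ideal0.
by move=> x y; apply: left_idealD.
Qed.

Lemma left_idealT : left_ideal [set: R].
Proof. by apply/left_idealP. Qed.

Lemma left_idealI I J : left_ideal I -> left_ideal J -> left_ideal (I `&` J).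
Proof.
move=> lI lJ; apply/left_idealP; split=> [|x y [Ix Jx] [Iy Jy]|r x [Ix Jx]].
- by split; apply: left_ideal0.
- by split; apply: left_idealD.
- by split; apply: left_idealM.
Qed.

Lemma neq_set0P I : left_ideal I -> I != [set 0] <-> exists2 x, I x & x != 0.
Proof.
move=> lI; split=> [|[x Ix x0]].
  apply: contra_neqP => nI; apply/seteqP; split=> [x Ix|_ ->]; last first.
    exact: left_ideal0.
  by have [//|x0] := eqVneq x 0; case: nI; exists x.
by apply: contra_neq x0 => eI; move: Ix; rewrite eI.
Qed.

Definition principal x : set R := [set y | exists r, y = r * x].

Lemma left_ideal_principal x : left_ideal (principal x).
Proof.
apply/left_idealP; split=> [|_ _ [r ->] [s ->]|r _ [s ->]].
- by exists 0; rewrite mul0r.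
- by exists (r + s); rewrite mulrDl.
- by exists (r * s); rewrite mulrA.
Qed.

Lemma mem_principal x : principal x x.
Proof. by exists 1; rewrite mul1r. Qed.

Lemma principal_sub I x : left_ideal I -> I x -> principal x `<=` I.
Proof. by move=> lI Ix _ [r ->]; apply: left_idealM. Qed.

Lemma principal_neq0 x : x != 0 -> principal x != [set 0].
Proof.
move=> x0; apply/(neq_set0P (left_ideal_principal x)).
by exists x => //; apply: mem_principal.
Qed.

Lemma left_ideal_ideal_sum n (L : 'I_n -> set R) :
  (forall i, left_ideal (L i)) -> left_ideal (ideal_sum L).
Proof.
move=> lL; apply/left_idealP; split=> [|x y [a La ->] [b Lb ->]|r x [a La ->]].
- by exists (fun _ => 0) => [i|]; [apply: left_ideal0 | rewrite big1].
- exists (fun i => a i + b i) => [i|]; first exact: left_idealD.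
  by rewrite big_split.
- exists (fun i => r * a i) => [i|]; first exact: left_idealM.
  by rewrite mulr_sumr.
Qed.

Lemma ideal_sum_mem n (L : 'I_n -> set R) i x :
  (forall i, left_ideal (L i)) -> L i x -> ideal_sum L x.
Proof.
move=> lL Lx; exists (fun j => if j == i then x else 0) => [j|].
  by case: eqP => [->|_] //; apply: left_ideal0.
by rewrite -big_mkcond big_pred1_eq.
Qed.

Lemma simple_left_ideal_sub S A x :
  simple_left_ideal S -> left_ideal A -> A x -> S x -> x != 0 -> S `<=` A.
Proof.
move=> [lS _ minS] lA Ax Sx x0.
have [] := minS (S `&` A) (left_idealI lS lA); first by move=> y [].
  move=> SA0; have : (S `&` A) x by [].
  by rewrite SA0 => /= x00; rewrite x00 eqxx in x0.
by move=> <- y [].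
Qed.

(** With [A = {y | y R x = 0}] and [B] the right annihilator of [A], the
two-sided ideal [A :&: B] contains [x] and squares to zero. *)
Lemma semiprime_elt x : semiprime R -> (forall r, x * r * x = 0) -> x = 0.
Proof.
move=> spR xRx.
pose A : set R := [set y | forall r, y * r * x = 0].
pose B : set R := [set y | forall z, A z -> z * y = 0].
have A_mulr y r : A y -> A (y * r) by move=> Ay s; rewrite -(mulrA y).
have tA : two_sided_ideal (A `&` B).
  split=> [|y r [Ay By]]; last first.
    by split=> [|z Az]; [apply: A_mulr | rewrite mulrA By ?mul0r].
  apply/left_idealP; split=> [|y z [Ay By] [Az Bz]|r y [Ay By]].
  - by split=> r; rewrite ?mul0r // mulr0.
  - by split=> [r|w Aw]; rewrite ?mulrDl ?mulrDr ?Ay ?Az ?By ?Bz ?addr0.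
  - split=> [s|w Aw]; first by rewrite -!mulrA [y * _]mulrA Ay mulr0.
    by rewrite mulrA; apply: By; apply: A_mulr.
have nA : nilpotent_ideal (A `&` B).
  exists 2 => a Ia; rewrite !big_ord_recl big_ord0 mulr1.
  by apply: (Ia _).2; apply: (Ia _).1.
have := spR _ tA nA => /seteqP[+ _]; apply; split=> // z Az.
by have := Az 1; rewrite mulr1.
Qed.

Lemma semiprime_left_ideal I :
  semiprime R -> left_ideal I -> (forall x y, I x -> I y -> x * y = 0) ->
  forall x, I x -> x = 0.
Proof.
move=> spR lI II x Ix; apply: semiprime_elt => // r.
by rewrite -mulrA; apply: II => //; apply: left_idealM.
Qed.

(** * Essential and uniform left ideals *)

Lemma essentialP I :
  left_ideal I ->
  essential_left_ideal I <->
    (forall x, x != 0 -> exists r, I (r * x) /\ r * x != 0).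
Proof.
move=> lI; split=> [[_ eI] x x0|eI].
  have lx := left_ideal_principal x.
  have /(neq_set0P (left_idealI lI lx))[y [Iy [r ey]] y0] :=
    eI _ lx (principal_neq0 x0).
  by exists r; rewrite -ey.
split=> // J lJ /(neq_set0P lJ)[x Jx /eI[r [Irx rx0]]].
apply/(neq_set0P (left_idealI lI lJ)); exists (r * x) => //.
by split=> //; apply: left_idealM.
Qed.

Lemma essentialI I J :
  essential_left_ideal I -> essential_left_ideal J ->
  essential_left_ideal (I `&` J).
Proof.
move=> eI eJ; have [lI lJ] := (eI.1, eJ.1).
apply/essentialP => [|x x0]; first exact: left_idealI.
have [r [Irx rx0]] := (essentialP lI).1 eI x x0.
have [s [Jsrx srx0]] := (essentialP lJ).1 eJ _ rx0.
by exists (s * r); rewrite -mulrA; split=> //; split=> //; apply: left_idealM.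
Qed.

Lemma left_ideal_preim I y :
  left_ideal I -> left_ideal [set r | I (r * y)].
Proof.
move=> lI; apply/left_idealP; split=> [|r s /= Ir Is|r s /= Is].
- by rewrite /= mul0r; apply: left_ideal0.
- by rewrite mulrDl; apply: left_idealD.
- by rewrite -mulrA; apply: left_idealM.
Qed.

Lemma essential_preim I y :
  essential_left_ideal I -> essential_left_ideal [set r | I (r * y)].
Proof.
move=> eI; have lI := eI.1; have lP := left_ideal_preim y lI.
apply/essentialP => // x x0.
have [xy0|xy0] := eqVneq (x * y) 0.
  by exists 1; rewrite /= mul1r xy0; split=> //; apply: left_ideal0.
have [r [Irxy rxy0]] := (essentialP lI).1 eI _ xy0.
exists r => /=; split; first by rewrite -mulrA.
by apply: contra_neq rxy0; rewrite mulrA => ->; rewrite mul0r.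
Qed.

Lemma uniform_common U x y :
  uniform_left_ideal U -> U x -> U y -> x != 0 -> y != 0 ->
  exists r s, r * x = s * y /\ r * x != 0.
Proof.
move=> [lU _ uU] Ux Uy x0 y0.
have [lx ly] := (left_ideal_principal x, left_ideal_principal y).
have := uU _ _ lx ly (principal_sub lU Ux) (principal_sub lU Uy)
  (principal_neq0 x0) (principal_neq0 y0).
by move=> /(neq_set0P (left_idealI lx ly))[_ [[r ->] [s e]] rx0]; exists r, s.
Qed.

(** A nonzero submodule of a uniform module is essential in it, and essential
submodules pull back to essential ones along [r |-> r u]. *)
Lemma uniform_meet_preim_essential U A u :
  uniform_left_ideal U -> left_ideal A -> (exists2 x, A x /\ U x & x != 0) ->
  U u -> essential_left_ideal [set r | A (r * u)].
Proof.
move=> uU lA [x [Ax Ux] x0] Uu; have lU : left_ideal U by case: uU.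
apply/essentialP => [|y y0]; first exact: left_ideal_preim.
have [yu0|yu0] := eqVneq (y * u) 0.
  by exists 1; rewrite /= mul1r yu0; split=> //; apply: left_ideal0.
have [r [s [rs ryu0]]] :=
  uniform_common uU (left_idealM y lU Uu) Ux yu0 x0.
exists r => /=; split; first by rewrite -mulrA rs; apply: left_idealM.
by apply: contra_neq ryu0; rewrite mulrA => ->; rewrite mul0r.
Qed.

(** * Uniform dimension *)

Section UniformDimension.
Variables (n : nat) (U : 'I_n -> set R).
Hypotheses (uniU : forall i, uniform_left_ideal (U i))
           (dirU : direct_ideal_sum U)
           (essU : essential_left_ideal (ideal_sum U)).

Let liU i : left_ideal (U i). Proof. by case: (uniU i). Qed.

(** The components of an element of the sum are pushed into [V] one after
the other, by left multiplications that do not kill the component concerned;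
directness keeps the whole element nonzero. *)
Lemma essential_of_meets V :
  left_ideal V -> (forall i, exists2 x, V x /\ U i x & x != 0) ->
  essential_left_ideal V.
Proof.
move=> lV meetV; apply/essentialP => // x x0.
have step k : (k <= n)%N -> exists r (a : 'I_n -> R),
    [/\ forall i, U i (a i), forall i : 'I_n, (i < k)%N -> V (a i),
        r * x = \sum_i a i & r * x != 0].
  elim: k => [_|k IHk kn].
    have [r [[a Ua ra] rx0]] := (essentialP essU.1).1 essU x x0.
    by exists r, a.
  have [r [a [Ua Va rx rx0]]] := IHk (ltnW kn).
  pose k' := Ordinal kn.
  have [ak0|ak0] := eqVneq (a k') 0.
    exists r, a; split=> // i; rewrite ltnS leq_eqVlt => /orP[/eqP ik|/Va//].
    by rewrite (_ : i = k') ?ak0; [apply: left_ideal0 | apply: val_inj].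
  have [v [Vv Uv] v0] := meetV k'.
  have [s [t [st sa0]]] := uniform_common (uniU k') (Ua k') Uv ak0 v0.
  exists (s * r), (fun i => s * a i); split=> [i|i||].
  - exact: left_idealM.
  - rewrite ltnS leq_eqVlt => /orP[/eqP ik|/Va ?]; last exact: left_idealM.
    by rewrite (_ : i = k') ?st; [apply: left_idealM | apply: val_inj].
  - by rewrite -mulrA rx mulr_sumr.
  - rewrite -mulrA rx mulr_sumr; apply: contra_neq sa0 => sum0.
    by rewrite (dirU (a := fun i => s * a i)) // => i; apply: left_idealM.
have [r [a [_ Va rx rx0]]] := step n (leqnn n).
by exists r; split=> //; rewrite rx; apply: left_ideal_sum => // i; apply: Va.
Qed.

Definition subsum (T : {set 'I_n}) : set R :=
  [set x | exists a : 'I_n -> R,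
    [/\ forall i, U i (a i), forall i, i \notin T -> a i = 0 & x = \sum_i a i]].

Lemma left_ideal_subsum T : left_ideal (subsum T).
Proof.
apply/left_idealP; split=> [|x y|r x].
- by exists (fun _ => 0); split=> // [i|]; [apply: left_ideal0|rewrite big1].
- move=> [a [Ua aT ->]] [b [Ub bT ->]]; exists (fun i => a i + b i).
  split=> [i|i iT|]; first exact: left_idealD.
    by rewrite aT ?bT ?addr0.
  by rewrite big_split.
- move=> [a [Ua aT ->]]; exists (fun i => r * a i).
  split=> [i|i iT|]; first exact: left_idealM.
    by rewrite aT ?mulr0.
  by rewrite mulr_sumr.
Qed.

Lemma subsum_mem (T : {set 'I_n}) i x : i \in T -> U i x -> subsum T x.
Proof.
move=> iT Ux; exists (fun j => if j == i then x else 0); split=> [j|j|].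
- by case: eqP => [->|_] //; apply: left_ideal0.
- by case: eqP => // ->; rewrite iT.
- by rewrite -big_mkcond big_pred1_eq.
Qed.

(** [#|T|] measures how far [A] is from being essential. The set [T] can be
enlarged, since otherwise [A' + subsum T] would meet every [U i], so it would be
essential and meet [V]; but as [A :&: subsum T = 0], an element of
[V :&: (A' + subsum T)] lies in [V :&: A' = 0]. *)
Lemma subsum_extend A A' (T : {set 'I_n}) :
  left_ideal A -> left_ideal A' -> A' `<=` A ->
  (exists V, [/\ left_ideal V, V `<=` A, V != [set 0] & V `&` A' = [set 0]]) ->
  A `&` subsum T = [set 0] ->
  exists2 i, i \notin T & A' `&` subsum (i |: T)%SET = [set 0].
Proof.
move=> lA lA' A'A [V [lV VA V0 VA'0]] AT0; apply: contrapT => noext.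
have lT := left_ideal_subsum T.
pose W := [set x | exists a t, [/\ A' a, subsum T t & x = a + t]].
have lW : left_ideal W.
  apply/left_idealP; split=> [|x y [a [t [? ? ->]]] [b [s [? ? ->]]]|
                               r x [a [t [? ? ->]]]].
  - by exists 0, 0; rewrite addr0; split=> //; apply: left_ideal0.
  - by exists (a + b), (t + s); rewrite addrACA; split=> //; apply: left_idealD.
  - by exists (r * a), (r * t); rewrite mulrDr; split=> //; apply: left_idealM.
have essW : essential_left_ideal W.
  apply: essential_of_meets => // i.
  have [iT|iT] := boolP (i \in T).
    have [_ /(neq_set0P (liU i))[x Ux x0] _] := uniU i.
    exists x => //; split=> //; exists 0, x; rewrite add0r.
    by split=> //; [apply: left_ideal0 | apply: subsum_mem Ux].
  have : A' `&` subsum (i |: T)%SET != [set 0].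
    by apply/eqP => e; apply: noext; exists i.
  case/(neq_set0P (left_idealI lA' (left_ideal_subsum _))).
  move=> y [A'y [a [Ua aT ey]]] y0.
  pose t := \sum_(j | j != i) a j.
  have Tt : subsum T t.
    exists (fun j => if j != i then a j else 0); split=> [j|j jT|].
    - by case: ifP => // _; apply: left_ideal0.
    - by case: ifP => // ji; apply: aT; rewrite !inE negb_or ji.
    - by rewrite -big_mkcond.
  have eai : a i = y - t by rewrite ey (bigD1 i) //= addrK.
  exists (a i); first split=> //.
    by exists y, (- t); split=> //; apply: left_idealN.
  apply: contra_neq y0; rewrite eai => /eqP; rewrite subr_eq0 => /eqP yt.
  by have : (A `&` subsum T) y; [split; [apply: A'A | rewrite yt] | rewrite AT0].
have /(neq_set0P lV)[v Vv v0] := V0.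
have [r [[a [t [A'a Tt rv]]] /eqP[]]] := (essentialP lW).1 essW v v0.
have Vrv : V (r * v) by apply: left_idealM.
have t0 : t = 0.
  have : (A `&` subsum T) t; last by rewrite AT0.
  split=> //; rewrite (_ : t = r * v - a); last by rewrite rv addrC addKr.
  by apply: left_idealB => //; [apply: VA | apply: A'A].
have : (V `&` A') (r * v); last by rewrite VA'0.
by split=> //; rewrite rv t0 addr0.
Qed.

(** A uniform submodule is found at a nonzero [x] whose decomposition has the
fewest nonzero components: [R x] then embeds into each [U i] at which the
component of [x] is nonzero. *)
Lemma uniform_sub_of_uniform_sum I :
  left_ideal I -> I != [set 0] -> exists2 V, uniform_left_ideal V & V `<=` I.
Proof.
move=> lI /(neq_set0P lI)[x0 Ix0 x0N0].
pose good k := exists2 x, I x /\ x != 0 &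
  exists2 a : 'I_n -> R, (forall i, U i (a i)) /\ x = \sum_i a i &
    #|[set i | a i != 0]%SET| = k.
have exgood : exists k, `[< good k >].
  have [r [[a Ua ra] rx0]] := (essentialP essU.1).1 essU x0 x0N0.
  exists #|[set i | a i != 0]%SET|; apply/asboolP; exists (r * x0).
    by split=> //; apply: left_idealM.
  by exists a.
have [k /asboolP[x [Ix xN0] [a [Ua xa] ak]] mink] := ex_minnP exgood.
have lx := left_ideal_principal x.
have [i ai0] : exists i, a i != 0.
  apply: contrapT => na; case/eqP: xN0; rewrite xa big1 // => i _.
  by apply: contrapT => ai; apply: na; exists i; apply/eqP.
have inj r : r * a i = 0 -> r * x = 0.
  move=> rai; apply: contrapT => /eqP rx0.
  have /mink : `[< good #|[set j | r * a j != 0]%SET| >].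
    apply/asboolP; exists (r * x); first by split=> //; apply: left_idealM.
    exists (fun j => r * a j) => //; split=> [j|]; first exact: left_idealM.
    by rewrite xa mulr_sumr.
  rewrite -ak leqNgt => /negP[]; apply: proper_card.
  apply/properP; split=> [|]; last by exists i; rewrite !inE ?rai ?eqxx.
  apply/fintype.subsetP => j; rewrite !inE; apply: contra_neq => ->.
  by rewrite mulr0.
have def r j : r * x = 0 -> r * a j = 0.
  rewrite xa mulr_sumr => rx; apply: (dirU (a := fun j => r * a j)) => // l.
  exact: left_idealM.
exists (principal x); last exact: principal_sub.
split=> //; first exact: principal_neq0.
move=> A B lA lB Ax Bx /(neq_set0P lA)[y Ay y0] /(neq_set0P lB)[z Bz z0].
have [r er] := Ax _ Ay; have [s es] := Bx _ Bz.
have nz t w : w = t * x -> w != 0 -> t * a i != 0.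
  by move=> -> ; apply: contra_neq; apply: inj.
have [p [q [pq pr0]]] := uniform_common (uniU i)
  (left_idealM r (liU i) (Ua i)) (left_idealM s (liU i) (Ua i))
  (nz _ _ er y0) (nz _ _ es z0).
have eyz : p * y = q * z.
  apply/eqP; rewrite -subr_eq0 er es !mulrA -mulrBl; apply/eqP/inj.
  by rewrite mulrBl -!mulrA pq subrr.
apply/(neq_set0P (left_idealI lA lB)); exists (p * y).
  by split; [|rewrite eyz]; apply: left_idealM.
apply: contra_neq pr0 => py0; rewrite mulrA; apply: def.
by rewrite -mulrA -er.
Qed.

End UniformDimension.

Lemma exists_uniform_sub I :
  finite_left_udim R -> left_ideal I -> I != [set 0] ->
  exists2 V, uniform_left_ideal V & V `<=` I.
Proof.
move=> [n [U [uU dU eU]]] lI.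
exact: uniform_sub_of_uniform_sum uU dU eU I lI.
Qed.

(** Passing from [A] to a left ideal inside [A] that misses a nonzero left
ideal inside [A] lowers the uniform dimension; hence such steps cannot be repeated
for ever, and induction along them is allowed. *)
Lemma finite_left_udim_ind (P : set R -> Prop) :
  finite_left_udim R ->
  (forall A, left_ideal A ->
    (forall A' V, left_ideal A' -> A' `<=` A -> left_ideal V -> V `<=` A ->
       V != [set 0] -> V `&` A' = [set 0] -> P A') -> P A) ->
  forall A, left_ideal A -> P A.
Proof.
move=> [n [U [uU dU eU]]] IH A lA.
have liU i : left_ideal (U i) by case: (uU i).
suff: forall k T B, left_ideal B -> B `&` subsum U T = [set 0] ->
    (n - #|T| < k)%N -> P B.
  move=> /(_ n.+1 finset.set0); apply=> //; last by rewrite cards0 subn0.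
  apply/seteqP; split=> [x [_ [a [_ a0 ->]]]|_ ->].
    by rewrite /= big1 // => i _; apply: a0; rewrite inE.
  by split; apply: left_ideal0 => //; apply: left_ideal_subsum.
elim=> // k IHk T B lB BT0 Tk; apply: IH => // A' V lA' A'B lV VB V0 VA'0.
have [|i iT A'T] := subsum_extend uU dU eU lB lA' A'B _ BT0.
  by exists V.
apply: (IHk (i |: T)%SET) => //.
have Tn : (#|T| < n)%N.
  rewrite -[n in (_ < n)%N]card_ord -cardsT; apply: proper_card.
  by apply/properP; split; [apply/fintype.subsetP|exists i].
rewrite cardsU1 iT /= add1n; rewrite ltnS in Tk.
by apply: leq_trans Tk; rewrite subnS prednK ?subn_gt0.
Qed.

End LeftIdeals.

(** * Essential left ideals contain regular elements *)

Section LeftRegular.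
Variable R : pzRingType.
Implicit Types (I U A : set R) (x y r c d : R).

Lemma acc_on_max (F : set (set R)) :
  acc_on F -> F !=set0 ->
  exists2 A, F A & forall B, F B -> A `<=` B -> B `<=` A.
Proof.
move=> accF [A0 FA0]; apply: contrapT => nomax.
have next (A : {A | F A}) : exists B : {B | F B},
    sval A `<=` sval B /\ ~ (sval B `<=` sval A).
  case: A => A FA /=; apply: contrapT => noB; apply: nomax; exists A => // B FB AB.
  by apply: contrapT => nBA; apply: noB; exists (exist _ B FB).
have [g gP] := choice next.
pose A k := iter k g (exist _ A0 FA0).
have [||N stop] := accF (fun k => sval (A k)).
  by move=> k; exact: (svalP (A k)).
  by move=> k; have [] := gP (A k).
have [_] := gP (A N); apply.
by have -> : sval (g (A N)) = sval (A N) by exact: (stop N.+1).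
Qed.

Lemma left_ideal_lann c : left_ideal [set x | x * c = 0].
Proof.
apply/left_idealP; split=> [|x y /= x0 y0|r x /= x0]; first by rewrite /= mul0r.
- by rewrite mulrDl x0 y0 addr0.
- by rewrite -mulrA x0 mulr0.
Qed.

(** The element is built as [u_1 + ... + u_k], where [u_{i+1}] acts injectively
on a uniform left ideal [U_{i+1}] inside [I] and inside the left annihilator of
[c = u_1 + ... + u_i]. The invariant [x c c = 0 -> x c = 0] makes the left
annihilator of [c + u] the intersection of those of [c] and [u]; as it misses
[U_{i+1}], the process stops. *)
Lemma essential_left_regular I :
  finite_left_udim R ->
  (forall U, uniform_left_ideal U -> left_regular_in U !=set0) ->
  essential_left_ideal I -> exists2 c, I c & left_regular R c.
Proof.
move=> fdR regU eI; have lI := eI.1.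
pose P A := forall c, A = [set x | x * c = 0] -> I c ->
  (forall x, x * c * c = 0 -> x * c = 0) -> exists2 c, I c & left_regular R c.
suff /(_ setT (left_idealT R) 0) : forall A, left_ideal A -> P A.
  apply.
  - by apply/seteqP; split=> x //= _; rewrite mulr0.
  - exact: left_ideal0.
  - by move=> x _; rewrite mulr0.
apply: finite_left_udim_ind => // A lA IH c eA Ic cc.
have [A0|A0] := eqVneq A [set 0].
  by exists c => // x xc0; have : A x; [rewrite eA | rewrite A0].
have AI0 : A `&` I != [set 0] by rewrite setIC; apply: eI.2.
have [U uU UAI] := exists_uniform_sub fdR (left_idealI lA lI) AI0.
have [lU UN0 _] := uU; have [u [Uu uinj]] := regU U uU.
have uU0 x : U x -> x * u = 0 -> x = 0.
  move=> Ux xu0; apply: uinj; rewrite ?inE //=; first exact: left_ideal0.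
  by rewrite mul0r.
have [Au Iu] := UAI _ Uu.
have uc0 : u * c = 0 by move: Au; rewrite eA.
have lannD x : x * (c + u) = 0 -> x * c = 0 /\ x * u = 0.
  move=> xcu; have xc : x * c = 0.
    apply: cc; move/(congr1 ( *%R^~ c)): xcu.
    by rewrite mulrDr mulrDl mul0r -(mulrA x u) uc0 mulr0 addr0.
  by split=> //; move: xcu; rewrite mulrDr xc add0r.
apply: (IH [set x | x * (c + u) = 0] U) => //.
- exact: left_ideal_lann.
- by move=> x /lannD[xc _]; rewrite eA.
- by move=> x /UAI[].
- apply/seteqP; split=> [x [Ux /lannD[_ xu]]|_ ->]; first exact: uU0.
  by split=> /=; rewrite ?mul0r //; apply: left_ideal0.
- exact: left_idealD.
move=> x /lannD[]; rewrite -!mulrA !mulrDl uc0 addr0 !mulrDr !mulrA => xc2 xu2.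
have xc0 := cc x xc2.
rewrite xc0 add0r; apply: uU0; first exact: left_idealM.
by rewrite -xu2 xc0 mul0r add0r.
Qed.

(** If [R x] misses [R c] and [x != 0], then [R x c ^+ k] is a nonzero left ideal
inside [R c ^+ k] that misses [R c ^+ k.+1], for every [k]. *)
Lemma principal_left_regular_essential c :
  finite_left_udim R -> left_regular R c -> essential_left_ideal (principal c).
Proof.
move=> fdR rc; have lc := left_ideal_principal c.
apply/essentialP => // x x0; apply: contrapT => miss.
have x_c r s : r * x = s * c -> r * x = 0.
  move=> e; apply: contrapT => /eqP rx0; apply: miss; exists r; split=> //.
  by exists s.
have rck k y : y * c ^+ k = 0 -> y = 0.
  elim: k y => [|k IHk] y; first by rewrite mulr1.
  by rewrite exprS mulrA => /IHk/rc.
pose P A := forall k, A = principal (c ^+ k) -> False.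
suff /(_ _ (left_ideal_principal (c ^+ 0)) 0%N) : forall A, left_ideal A -> P A.
  by apply.
apply: finite_left_udim_ind => // A _ IH k eA; rewrite {}eA in IH.
apply: (IH (principal (c ^+ k.+1)) (principal (x * c ^+ k))) (k.+1) erefl.
- exact: left_ideal_principal.
- by move=> _ [r ->]; exists (r * c); rewrite exprS mulrA.
- exact: left_ideal_principal.
- by move=> _ [r ->]; exists (r * x); rewrite mulrA.
- by apply: principal_neq0; apply: contra_neq x0 => /rck.
apply/seteqP; split=> [y [[r ->] [s e]]|_ ->]; last first.
  by split; apply: left_ideal0; apply: left_ideal_principal.
have /x_c rx0 : r * x = s * c.
  apply/eqP; rewrite -subr_eq0; apply/eqP/(rck k).
  by rewrite mulrBl -!mulrA -exprS e subrr.
by rewrite /= mulrA rx0 mul0r.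
Qed.

(** Two left ideals [R c] and [R d] with [c], [d] left regular have an essential
intersection, so the kernels of left regular elements are directed, and a maximal
one, [N = ker_lmul c], is the largest. Then [N] is a two-sided ideal (the left
singular ideal of [R]). As [R c N = 0], the left ideal [R c :&: N] squares to
zero; semiprimeness makes it zero, and so is [N] because [R c] is essential. *)
Lemma left_regular_regular :
  semiprime R -> finite_left_udim R ->
  acc_on [set ker_lmul c | c in left_regular R] ->
  (forall U, uniform_left_ideal U -> left_regular_in U !=set0) ->
  forall c, left_regular R c -> regular R c.
Proof.
move=> spR fdR accR regU.
have ess := principal_left_regular_essential fdR.
have reg I := essential_left_regular (I := I) fdR regU.
have [|_ [c rc <-] maxc] := acc_on_max accR.
  by exists (ker_lmul 1), 1 => // x; rewrite mulr1.
have kerS d : left_regular R d -> ker_lmul d `<=` ker_lmul c.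
  move=> rd; have [e [[r er] [s es]] re] := reg _ (essentialI (ess _ rc) (ess _ rd)).
  have ce : ker_lmul c `<=` ker_lmul e.
    by move=> x; rewrite /ker_lmul /= er -mulrA => ->; rewrite mulr0.
  have de : ker_lmul d `<=` ker_lmul e.
    by move=> x; rewrite /ker_lmul /= es -mulrA => ->; rewrite mulr0.
  by apply: subset_trans de _; apply: maxc => //; exists e.
have lN : left_ideal (ker_lmul c).
  apply/left_idealP; split=> [|x y /= cx cy|r x /= cx]; rewrite /ker_lmul /=.
  - by rewrite mulr0.
  - by rewrite mulrDr cx cy addr0.
  - (* the left ideal of all [t] with [t r] in [R c] is essential, so some left
       regular [d] satisfies [d r x = 0] *)
    have [d [s es] rd] := reg _ (essential_preim r (ess _ rc)).
    by apply: (kerS d rd); rewrite /ker_lmul /= mulrA es -mulrA cx mulr0.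
have lc := left_ideal_principal c.
have N0 : ker_lmul c = [set 0].
  apply: contrapT => /eqP /((ess _ rc).2 _ lN).
  have lcN := left_idealI lc lN; move=> /(neq_set0P lcN)[x cNx /eqP[]].
  apply: semiprime_left_ideal cNx => // _ y [[r ->] _] [_ cy].
  by rewrite -mulrA cy mulr0.
move=> d rd; split=> // x dx.
by have := kerS d rd x dx; rewrite N0.
Qed.

End LeftRegular.

Definition essential_regular (R : pzRingType) : Prop :=
  forall I : set R, essential_left_ideal I -> exists2 c, I c & regular R c.

Definition left_ore (R : pzRingType) : Prop :=
  forall r c : R, regular R c -> exists d s, regular R d /\ d * r = s * c.

Lemma essential_regular_left_ore (R : pzRingType) :
  finite_left_udim R -> essential_regular R -> left_ore R.
Proof.
move=> fdR erR r c [rc _].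
have [d [s es] rd] :=
  erR _ (essential_preim r (principal_left_regular_essential fdR rc)).
by exists d, s.
Qed.

(** * The ring of left fractions *)

Section RegularElements.
Variable R : pzRingType.
Implicit Types x y r c d : R.

Lemma regular1 : regular R 1.
Proof. by split=> x; rewrite ?mulr1 ?mul1r. Qed.

Lemma regularM c d : regular R c -> regular R d -> regular R (c * d).
Proof.
move=> [lc rc] [ld rd]; split=> x; first by rewrite mulrA => /ld/lc.
by rewrite -mulrA => /rc/rd.
Qed.

Lemma regular_lcancel c x y : regular R c -> c * x = c * y -> x = y.
Proof.
move=> [_ rc] e; apply/eqP; rewrite -subr_eq0; apply/eqP/rc.
by rewrite mulrBr e subrr.
Qed.

End RegularElements.

(** A left fraction [q = c^-1 r] is encoded by the graph [x q = y] of right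
multiplication by [q] on [R]. Unlike pairs [(c, r)], graphs of equal fractions
are equal. *)
Record fraction_graph (R : pzRingType) (g : R -> R -> Prop) : Prop :=
  FractionGraph {
    graphD : forall x x' y y', g x y -> g x' y' -> g (x + x') (y + y');
    graphM : forall r x y, g x y -> g (r * x) (r * y);
    graph0 : forall y, g 0 y -> y = 0;
    graph_sat : forall d x y, regular R d -> g (d * x) (d * y) -> g x y;
    graph_dom : exists c r, regular R c /\ g c r }.

Record fraction (R : pzRingType) (oreR : left_ore R) := Fraction {
  graph :> R -> R -> Prop;
  graphP : fraction_graph graph }.

Section Fractions.
Variables (R : pzRingType) (oreR : left_ore R).
Local Notation Q := (fraction oreR).
Implicit Types (p q s : Q) (x y r c d : R).

HB.instance Definition _ := gen_eqMixin Q.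
HB.instance Definition _ := gen_choiceMixin Q.

Lemma graph_fun q x y y' : q x y -> q x y' -> y = y'.
Proof.
move=> qy qy'; apply/eqP; rewrite -subr_eq0; apply/eqP/(graph0 (graphP q)).
have := graphD (graphP q) qy (graphM (graphP q) (- 1) qy').
by rewrite !mulN1r subrr.
Qed.

Lemma graph_mul q r x y : q x y -> q (r * x) (r * y).
Proof. exact: (graphM (graphP q)). Qed.

Lemma graph_total q x : exists d y, regular R d /\ q (d * x) y.
Proof.
have [c [r [rc qcr]]] := graph_dom (graphP q).
have [d [s [rd e]]] := oreR x rc.
by exists d, (s * r); split=> //; rewrite e; apply: graph_mul.
Qed.

(** [q] is determined by [c q = r], as it is then [c^-1 r]. *)
Lemma fraction_eq p q c r : regular R c -> p c r -> q c r -> p = q.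
Proof.
have sub p' q' : regular R c -> p' c r -> q' c r -> forall x y, p' x y -> q' x y.
  move=> rc pcr qcr x y pxy; have [d [e [rd ed]]] := oreR x rc.
  apply: (graph_sat (graphP q') rd); rewrite ed (_ : d * y = e * r).
    exact: graph_mul.
  by apply: (@graph_fun p' (d * x)); [|rewrite ed]; apply: graph_mul.
move=> rc pcr qcr; case: p q pcr qcr (sub p q) (sub q p) => [p Pp] [q Pq] /=.
move=> pcr qcr pq qp; have e : p = q.
  apply/funext => x; apply/funext => y; apply/propext.
  by split; [apply: pq | apply: qp].
by case: _ / e Pq {pcr qcr pq qp} => Pq; congr Fraction; apply: Prop_irrelevance.
Qed.

Lemma divide_subproof c r : regular R c ->
  fraction_graph (fun x y => exists d e,
    [/\ regular R d, d * x = e * c & d * y = e * r]).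
Proof.
move=> rc; split.
- move=> x x' y y' [d [e [rd dx dy]]] [d' [e' [rd' dx' dy']]].
  have [a [b [ra ab]]] := oreR d rd'.
  exists (a * d), (a * e + b * e'); split; first exact: regularM.
    by rewrite mulrDr mulrDl -!mulrA dx -dx' !mulrA ab.
  by rewrite mulrDr mulrDl -!mulrA dy -dy' !mulrA ab.
- move=> t x y [d [e [rd dx dy]]]; have [a [b [ra ab]]] := oreR t rd.
  by exists a, (b * e); split; rewrite // mulrA ab -mulrA ?dx ?dy mulrA.
- move=> y [d [e [rd]]]; rewrite mulr0 => /esym/rc.1 -> dy.
  by apply: rd.2; rewrite dy mul0r.
- move=> d x y rd [d' [e [rd' dx dy]]]; exists (d' * d), e.
  by split; [apply: regularM | rewrite -mulrA | rewrite -mulrA].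
- exists c, r; split=> //; exists 1, 1; split=> //; exact: regular1.
Qed.

Definition divide c r (rc : regular R c) : Q :=
  Fraction oreR (divide_subproof r rc).

Lemma divideE c r (rc : regular R c) : divide r rc c r.
Proof. by exists 1, 1; split=> //; apply: regular1. Qed.

Lemma embed_subproof r : fraction_graph (fun x y => y = x * r).
Proof.
split=> [x x' y y' -> ->|s x y ->|y ->|d x y rd|].
- by rewrite mulrDl.
- by rewrite mulrA.
- by rewrite mul0r.
- by rewrite -mulrA => /(regular_lcancel rd).
- by exists 1, r; rewrite mul1r; split=> //; apply: regular1.
Qed.

Definition embed r : Q := Fraction oreR (embed_subproof r).

(** Sums and products are characterized by their values at the [x] where they
can be computed within [R]; by [fraction_eq], one regular such [x] suffices to
determine them, and to check each ring axiom. *)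
Lemma add_subproof p q :
  exists s, forall x y z, p x y -> q x z -> s x (y + z).
Proof.
have [c [r [rc pcr]]] := graph_dom (graphP p).
have [d [z [rd qcz]]] := graph_total q c; have rdc := regularM rd rc.
exists (divide (d * r + z) rdc) => x y y' pxy qxy'.
have [a [b [ra ab]]] := oreR x rdc; exists a, b; split=> //.
rewrite !mulrDr; congr (_ + _).
  by apply: (@graph_fun p (a * x)); [|rewrite ab]; do !apply: graph_mul.
by apply: (@graph_fun q (a * x)); [|rewrite ab]; apply: graph_mul.
Qed.

Definition add p q : Q := sval (cid (add_subproof p q)).

Lemma addE p q x y z : p x y -> q x z -> add p q x (y + z).
Proof. exact: (svalP (cid (add_subproof p q))). Qed.

Lemma mul_subproof p q : exists s, forall x y z, p x y -> q y z -> s x z.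
Proof.
have [c [r [rc pcr]]] := graph_dom (graphP p).
have [d [z [rd qcz]]] := graph_total q r; have rdc := regularM rd rc.
exists (divide z rdc) => x y y' pxy qyy'.
have [a [b [ra ab]]] := oreR x rdc; exists a, b; split=> //.
apply: (@graph_fun q (a * y)); first exact: graph_mul.
rewrite (_ : a * y = b * (d * r)); first exact: graph_mul.
by apply: (@graph_fun p (a * x)); [|rewrite ab]; do !apply: graph_mul.
Qed.

Definition mul p q : Q := sval (cid (mul_subproof p q)).

Lemma mulE p q x y z : p x y -> q y z -> mul p q x z.
Proof. exact: (svalP (cid (mul_subproof p q))). Qed.

Definition opp q : Q := mul q (embed (- 1)).

Lemma oppE q x y : q x y -> opp q x (- y).
Proof. by move=> qxy; apply: mulE qxy _; rewrite /= mulrN1. Qed.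

Lemma fraction_addrA : associative add.
Proof.
move=> p q s; have [c [x [rc px]]] := graph_total p 1; rewrite mulr1 in px.
have [d [y [rd qy]]] := graph_total q c.
have [e [z [re sz]]] := graph_total s (d * c).
apply: (fraction_eq (regularM re (regularM rd rc))).
  apply: addE; first by do 2!apply: graph_mul; exact: px.
  by apply: addE sz; apply: graph_mul qy.
rewrite addrA; apply: addE sz; apply: addE; last exact: graph_mul qy.
by do 2!apply: graph_mul.
Qed.

Lemma fraction_addrC : commutative add.
Proof.
move=> p q; have [c [x [rc px]]] := graph_total p 1; rewrite mulr1 in px.
have [d [y [rd qy]]] := graph_total q c.
apply: (fraction_eq (regularM rd rc)); first exact: addE (graph_mul d px) qy.
by rewrite addrC; apply: addE qy (graph_mul d px).
Qed.

Lemma fraction_add0r : left_id (embed 0) add.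
Proof.
move=> p; have [c [x [rc px]]] := graph_dom (graphP p).
apply: (fraction_eq rc _ px); rewrite -[x]add0r; apply: addE px.
by rewrite /= mulr0.
Qed.

Lemma fraction_addNr : left_inverse (embed 0) opp add.
Proof.
move=> p; have [c [x [rc px]]] := graph_dom (graphP p).
apply: (fraction_eq rc); first exact: (addE (oppE px) px).
by rewrite /= mulr0 addNr.
Qed.

Lemma fraction_mulrA : associative mul.
Proof.
move=> p q s; have [c [x [rc px]]] := graph_total p 1; rewrite mulr1 in px.
have [d [y [rd qy]]] := graph_total q x.
have [e [z [re sz]]] := graph_total s y.
have qy' := graph_mul e qy; have px' := graph_mul e (graph_mul d px).
apply: (fraction_eq (regularM re (regularM rd rc))).
  by apply: mulE px' _; apply: mulE qy' sz.
by apply: mulE _ sz; apply: mulE px' qy'.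
Qed.

Lemma fraction_mul1r : left_id (embed 1) mul.
Proof.
move=> p; have [c [x [rc px]]] := graph_dom (graphP p).
by apply: (fraction_eq rc _ px); apply: mulE px; rewrite /= mulr1.
Qed.

Lemma fraction_mulr1 : right_id (embed 1) mul.
Proof.
move=> p; have [c [x [rc px]]] := graph_dom (graphP p).
by apply: (fraction_eq rc _ px); apply: mulE px _; rewrite /= mulr1.
Qed.

Lemma fraction_mulrDl : left_distributive mul add.
Proof.
move=> p q s; have [c [x [rc px]]] := graph_total p 1; rewrite mulr1 in px.
have [d [y [rd qy]]] := graph_total q c.
have [e [z [re sz]]] := graph_total s (d * x).
have [f [t [rf st]]] := graph_total s (e * y).
have px' := graph_mul f (graph_mul e (graph_mul d px)).
have qy' := graph_mul f (graph_mul e qy); have sz' := graph_mul f sz.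
apply: (fraction_eq (regularM rf (regularM re (regularM rd rc)))).
  exact: mulE (addE px' qy') (graphD (graphP s) sz' st).
by apply: addE; [apply: mulE px' sz' | apply: mulE qy' st].
Qed.

Lemma fraction_mulrDr : right_distributive mul add.
Proof.
move=> p q s; have [c [x [rc px]]] := graph_total p 1; rewrite mulr1 in px.
have [d [y [rd qy]]] := graph_total q x.
have [e [z [re sz]]] := graph_total s (d * x).
have px' := graph_mul e (graph_mul d px); have qy' := graph_mul e qy.
apply: (fraction_eq (regularM re (regularM rd rc))).
  by apply: mulE px' _; apply: addE qy' sz.
by apply: addE; apply: mulE px' _.
Qed.

HB.instance Definition _ := GRing.isPzRing.Build Q fraction_addrA fraction_addrC
  fraction_add0r fraction_addNr fraction_mulrA fraction_mul1r fraction_mulr1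
  fraction_mulrDl fraction_mulrDr.

Lemma embed_zmod_morphism : zmod_morphism embed.
Proof.
move=> x y; apply: (fraction_eq (regular1 R) (r := x - y)).
  by rewrite /= mul1r.
by apply: addE; [|apply: oppE]; rewrite /= mul1r.
Qed.

Lemma embed_monoid_morphism : monoid_morphism embed.
Proof.
split=> // x y; apply: (fraction_eq (regular1 R) (r := x * y)).
  by rewrite /= mul1r.
by apply: (@mulE _ _ _ x); rewrite /= ?mul1r.
Qed.

HB.instance Definition _ :=
  GRing.isZmodMorphism.Build R Q embed embed_zmod_morphism.
HB.instance Definition _ :=
  GRing.isMonoidMorphism.Build R Q embed embed_monoid_morphism.

Lemma divide_embed c (rc : regular R c) :
  is_inverse (embed c) (divide 1 rc).
Proof.
have rc1 := regular1 R; split.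
  apply: (fraction_eq rc1 (r := 1)); last by rewrite /= mul1r.
  by apply: mulE (divideE 1 rc); rewrite /= mul1r.
apply: (fraction_eq rc (r := c)); last by rewrite /= mulr1.
by apply: mulE (divideE 1 rc) _; rewrite /= mul1r.
Qed.

Lemma embed_classical_left_quotient_ring :
  classical_left_quotient_ring (embed : {rmorphism R -> Q}).
Proof.
split=> [x y exy|c rc|q].
- have : (embed x : Q) 1 y by rewrite exy /= mul1r.
  by rewrite /= mul1r.
- by exists (divide 1 rc); apply: divide_embed.
have [c [r [rc qcr]]] := graph_dom (graphP q).
exists c, r, (divide 1 rc); split=> //; first exact: divide_embed.
apply: (fraction_eq rc qcr); apply: mulE (divideE 1 rc) _.
by rewrite /= mul1r.
Qed.

End Fractions.

Lemma exists_classical_left_quotient_ring (R : pzRingType) :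
  left_ore R -> exists (Q : pzRingType) (f : {rmorphism R -> Q}),
    classical_left_quotient_ring f.
Proof.
move=> oreR; exists (fraction oreR), (embed oreR).
exact: embed_classical_left_quotient_ring.
Qed.

(** * Rings that are sums of simple left ideals *)

Section Semisimple.
Variable Q : pzRingType.

Lemma simple_left_ideal_ideal (S : set Q) : simple_left_ideal S -> left_ideal S.
Proof. by case. Qed.

(** A family with the smallest possible number of members is direct: in a
nontrivial relation [\sum_i a i = 0] with [a i != 0], the simple left ideal
[L i = Q (a i)] would lie in the sum of the others. *)
Lemma semisimple_direct_sum :
  semisimple Q -> exists n (L : 'I_n -> set Q),
    [/\ forall i, simple_left_ideal (L i), direct_ideal_sum L & ideal_sum L 1].
Proof.
move=> ssQ.
pose P n := exists L : 'I_n -> set Q,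
  (forall i, simple_left_ideal (L i)) /\ ideal_sum L 1.
have [n0 [L0 PL0]] := ssQ 1.
have exP : exists n, `[< P n >] by exists n0; apply/asboolP; exists L0.
have [n /asboolP[L [sL L1]] minn] := ex_minnP exP.
exists n, L; split=> // a La a0 i; apply: contrapT => /eqP ai0.
case: n i L sL L1 minn a La a0 ai0 => [[]//|n] i L sL L1 minn a La a0 ai0.
suff /minn : `[< P n >] by rewrite ltnn.
pose L' j := L (lift i j).
have lL j := simple_left_ideal_ideal (sL j).
have lL' : left_ideal (ideal_sum L') by apply: left_ideal_ideal_sum => j; apply: lL.
apply/asboolP; exists L'; split=> [j|]; first exact: sL.
have L'L j : L (lift i j) `<=` ideal_sum L'.
  by move=> x Lx; apply: (ideal_sum_mem (i := j)) => // k; apply: lL.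
have LiL' : L i `<=` ideal_sum L'.
  apply: (simple_left_ideal_sub (sL i) lL' _ (La i) ai0).
  move: a0; rewrite (bigD1_ord i) //= => /eqP; rewrite addr_eq0 => /eqP ->.
  apply: left_idealN => //; apply: left_ideal_sum => // j.
  exact: L'L (La _).
case: L1 => b Lb ->; apply: left_ideal_sum => // j.
by have [k ->|->] := unliftP i j; [apply: L'L (Lb _) | apply: LiL' (Lb _)].
Qed.

(** By induction on [n]: once the chain is stationary inside the sum [M] of the
first [n] members, and the left ideals of those [s] in the last member for which
[A k] meets [M + s] (each of them zero or the whole member) are stationary too,
the chain is stationary inside the full sum. *)
Lemma dcc_ideal_sum n (L : 'I_n -> set Q) (A : nat -> set Q) :
  (forall i, simple_left_ideal (L i)) -> (forall k, left_ideal (A k)) ->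
  (forall k, A k.+1 `<=` A k) ->
  exists N, forall k, (N <= k)%N -> A N `&` ideal_sum L `<=` A k.
Proof.
move=> sL lA decA.
have leA j k : (j <= k)%N -> A k `<=` A j.
  move=> /subnK <-; elim: (k - j)%N => // d IHd.
  by apply: subset_trans IHd; apply: decA.
elim: n L sL => [|n IHn] L sL.
  exists 0%N => k _ x [_ [a _ ->]]; rewrite big_ord0; exact: left_ideal0.
have lL j := simple_left_ideal_ideal (sL j).
pose L' i := L (widen_ord (leqnSn n) i); pose S := L ord_max.
have lL' : left_ideal (ideal_sum L') by apply: left_ideal_ideal_sum => i; apply: lL.
have [i|N1 stopN1] := IHn L'; first exact: sL.
pose B k := [set s | S s /\ exists2 m, ideal_sum L' m & A k (m + s)].
have lB k : left_ideal (B k).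
  apply/left_idealP; split=> [|x y [Sx [m L'm Ax]] [Sy [m' L'm' Ay]]|
                               r x [Sx [m L'm Ax]]].
  - split; first exact: left_ideal0 (lL _).
    by exists 0; rewrite ?addr0; apply: left_ideal0.
  - split; first exact: left_idealD (lL _) Sx Sy.
    exists (m + m'); first exact: left_idealD.
    by rewrite addrACA; apply: left_idealD.
  - split; first exact: left_idealM (lL _) Sx.
    by exists (r * m); [|rewrite -mulrDr]; apply: left_idealM.
have BS k : B k = [set 0] \/ B k = S.
  by have [_ _ minS] := sL ord_max; apply: minS => // x [].
have [N2 stopN2] : exists N2, forall k, (N2 <= k)%N -> B N2 `<=` B k.
  have [[k0 Bk0]|noB0] := pselect (exists k0, B k0 = [set 0]).
    by exists k0 => k _; rewrite Bk0 => _ ->; apply: left_ideal0.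
  exists 0%N => k _; have [Bk0|->] := BS k; first by case: noB0; exists k.
  by move=> x [].
exists (maxn N1 N2) => k; rewrite geq_max => /andP[N1k N2k] x [Ax [a La]].
rewrite big_ord_recr /=; set m := \sum_i _; set s := a ord_max => xms.
have L'm : ideal_sum L' m.
  by exists (fun i => a (widen_ord (leqnSn n) i)) => // i; apply: La.
have [_ [m' L'm' Am's]] : B k s.
  apply: stopN2 => //; split; first exact: La.
  by exists m => //; rewrite -xms; apply: leA Ax; apply: leq_maxr.
rewrite (_ : x = (m - m') + (m' + s)); last by rewrite xms addrA subrK.
apply: left_idealD => //; apply: (stopN1 k N1k); split; last exact: left_idealB.
rewrite (_ : m - m' = x - (m' + s)); last by rewrite xms opprD addrACA subrr addr0.
by apply: left_idealB => //; [apply: leA Ax; apply: leq_maxl | apply: leA Am's].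
Qed.

Lemma simple_sum_semisimple_artinian n (L : 'I_n -> set Q) :
  (forall i, simple_left_ideal (L i)) -> ideal_sum L 1 -> semisimple_artinian Q.
Proof.
move=> sL L1; have Lx x : ideal_sum L x.
  rewrite -[x]mulr1; apply: left_idealM => //; apply: left_ideal_ideal_sum => i.
  exact: simple_left_ideal_ideal (sL i).
split=> [x|A lA decA]; first by exists n, L.
have [N stopN] := dcc_ideal_sum sL lA decA.
exists N => k Nk; apply/seteqP; split=> x Akx; last by apply: (stopN k Nk).
by move: Nk Akx => /subnK <-; elim: (k - N)%N => // d IHd /decA/IHd.
Qed.

End Semisimple.

(** * Left ideals of a ring and of its ring of fractions *)

Section Extension.
Variables (R Q : pzRingType) (f : {rmorphism R -> Q}).
Hypothesis frac : classical_left_quotient_ring f.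
Implicit Types (I J W : set R) (A S : set Q) (x y r s c d : R) (p q : Q).

Let injf : injective f. Proof. by case: frac. Qed.

Lemma frac_neq0 x : x != 0 -> f x != 0.
Proof. by apply: contra_neq => fx; apply: injf; rewrite fx rmorph0. Qed.

Lemma frac_lcancel c p : regular R c -> f c * p = 0 -> p = 0.
Proof.
move=> rc cp; have [_ /(_ _ rc)[v [_ vc]] _] := frac.
by rewrite -[p]mul1r -vc -mulrA cp mulr0.
Qed.

Lemma frac_ideal_cancel A c p : left_ideal A -> regular R c -> A (f c * p) -> A p.
Proof.
move=> lA rc Acp; have [_ /(_ _ rc)[v [_ vc]] _] := frac.
by rewrite -[p]mul1r -vc -mulrA; apply: left_idealM.
Qed.

(** In [Q], this says [p c^-1 = d^-1 s]; at [p = f r] it is the Ore condition. *)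
Lemma frac_numer p c :
  regular R c -> exists d s, regular R d /\ f d * p = f (s * c).
Proof.
move=> rc; have [_ /(_ _ rc)[v [_ vc]] den] := frac.
have [d [s [w [rd [dw _] pv]]]] := den (p * v).
exists d, s; split=> //; rewrite rmorphM.
by rewrite -[p]mulr1 -vc [p * _]mulrA pv !mulrA dw mul1r.
Qed.

(** The left ideal [Q I] generated by [I], described by fractions. *)
Definition ext I : set Q :=
  [set q | exists c x, [/\ regular R c, I x & f c * q = f x]].

Lemma ext_mem I x : I x -> ext I (f x).
Proof. by exists 1, x; split; rewrite ?rmorph1 ?mul1r //; apply: regular1. Qed.

Lemma left_ideal_ext I : left_ideal I -> left_ideal (ext I).
Proof.
move=> lI; apply/left_idealP; split=> [|p q|p q].
- by rewrite -(rmorph0 f); apply: ext_mem; apply: left_ideal0.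
- move=> [c [x [rc Ix cp]]] [c' [x' [rc' Ix' cq]]].
  have [d [s [rd e]]] := frac_numer (f c') rc.
  exists (d * c'), (s * x + d * x'); split; first exact: regularM.
    by apply: left_idealD => //; apply: left_idealM.
  rewrite rmorphM mulrDr {1}e -[_ * q]mulrA cq !rmorphM -mulrA cp.
  by rewrite rmorphD !rmorphM.
- move=> [c [x [rc Ix cq]]]; have [d [s [rd e]]] := frac_numer p rc.
  exists d, (s * x); split=> //; first exact: left_idealM.
  by rewrite mulrA e !rmorphM -mulrA cq.
Qed.

(** A common denominator takes [q] into [I] and into [J] at once. *)
Lemma ext_meet I J q :
  left_ideal I -> left_ideal J -> ext I q -> ext J q -> q != 0 ->
  exists2 x, I x /\ J x & x != 0.
Proof.
move=> lI lJ [c [x [rc Ix cq]]] [c' [y [rc' Jy c'q]]] q0.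
have [d [s [rd e]]] := frac_numer (f c') rc.
have dy : d * y = s * x.
  by apply: injf; rewrite !rmorphM -c'q mulrA e rmorphM -mulrA cq.
exists (d * y); first by split; [rewrite dy|]; apply: left_idealM.
apply: contra_neq q0 => dy0; apply: (frac_lcancel (regularM rd rc')).
by rewrite rmorphM -mulrA c'q -rmorphM dy0 rmorph0.
Qed.

Lemma left_ideal_contract A : left_ideal A -> left_ideal (f @^-1` A).
Proof.
move=> lA; apply/left_idealP; split=> [|x y /= Ax Ay|r x /= Ax].
- by rewrite /= rmorph0; apply: left_ideal0.
- by rewrite rmorphD; apply: left_idealD.
- by rewrite rmorphM; apply: left_idealM.
Qed.

Lemma ext_contract A : left_ideal A -> A `<=` ext (f @^-1` A).
Proof.
move=> lA q Aq; have [d [s [rd e]]] := frac_numer q (regular1 R).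
by exists d, (s * 1); split=> //=; rewrite -e; apply: left_idealM.
Qed.

Lemma contract_neq0 A : left_ideal A -> A != [set 0] -> exists2 x, A (f x) & x != 0.
Proof.
move=> lA /(neq_set0P lA)[q Aq q0].
have lfA := left_ideal_contract lA.
have [x [Ax _] x0] := ext_meet lfA lfA (ext_contract lA Aq) (ext_contract lA Aq) q0.
by exists x.
Qed.

(** * From the ring of fractions to the ring *)

Lemma semisimple_essential_regular : semisimple Q -> essential_regular R.
Proof.
move=> ssQ W eW; have lW := eW.1; have lxW := left_ideal_ext lW.
have [n [L [sL [a La a1]]]] := ssQ 1.
suff [c [w [rc Ww cw]]] : ext W 1.
  by exists c => //; rewrite mulr1 in cw; rewrite (injf cw).
rewrite a1; apply: left_ideal_sum => // i.
have [lLi Li0 _] := sL i; have lfLi := left_ideal_contract lLi.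
have /(eW.2 _ lfLi)/(neq_set0P (left_idealI lW lfLi))[w [Ww Lw] w0] :
    f @^-1` L i != [set 0].
  have [x Lx x0] := contract_neq0 lLi Li0.
  by apply/(neq_set0P lfLi); exists x.
exact: (simple_left_ideal_sub (sL i) lxW (ext_mem Ww) Lw (frac_neq0 w0)).
Qed.

Lemma semisimple_finite_left_udim : semisimple Q -> finite_left_udim R.
Proof.
move=> /semisimple_direct_sum[n [L [sL dL L1]]].
have lL i := simple_left_ideal_ideal (sL i).
have lfL i := left_ideal_contract (lL i).
have lsum : left_ideal (ideal_sum (fun i => f @^-1` L i)).
  exact: left_ideal_ideal_sum.
exists n, (fun i => f @^-1` L i); split=> [i|a La a0 i|].
- have [_ Li0 _] := sL i; have [x0 Lx0 x00] := contract_neq0 (lL i) Li0.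
  split=> //; first by apply/(neq_set0P (lfL i)); exists x0.
  move=> I J lI lJ IL JL /(neq_set0P lI)[x Ix xN0] /(neq_set0P lJ)[y Jy yN0].
  have fx0 := frac_neq0 xN0.
  have LJ : L i `<=` ext J.
    exact: (simple_left_ideal_sub (sL i) (left_ideal_ext lJ) (ext_mem Jy)
             (JL _ Jy) (frac_neq0 yN0)).
  have [z [Iz Jz] z0] := ext_meet lI lJ (ext_mem Ix) (LJ _ (IL _ Ix)) fx0.
  by apply/(neq_set0P (left_idealI lI lJ)); exists z.
- apply: injf; rewrite rmorph0; apply: (dL (fun i => f (a i))) => //.
  by rewrite -rmorph_sum a0 rmorph0.
have [c [w [rc sw cw]]] : ext (ideal_sum (fun i => f @^-1` L i)) 1.
  case: L1 => a La ->; apply: left_ideal_sum; first exact: left_ideal_ext.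
  move=> i; have [c [x [rc Lx ca]]] := ext_contract (lL i) (La i).
  by exists c, x; split=> //; apply: (ideal_sum_mem (i := i)).
move: cw; rewrite mulr1 => /injf cw; rewrite -{}cw in sw.
apply/essentialP => // x x0.
have [d [s [rd e]]] := frac_numer (f x) rc.
have {}e : d * x = s * c by apply: injf; rewrite rmorphM.
exists d; split; first by rewrite e; apply: left_idealM.
by apply: contra_neq x0 => /rd.2.
Qed.

(** A right annihilator [A] is determined by the left annihilator of [f A] in
[Q], which reverses inclusions. *)
Lemma left_artinian_acc_right_annihilators :
  left_artinian Q -> acc_on (right_annihilators R).
Proof.
move=> artQ A rA incA.
pose B k := [set q : Q | forall x, A k x -> q * f x = 0].
have lB k : left_ideal (B k).
  apply/left_idealP; split=> [x _|p q Bp Bq x Ax|p q Bq x Ax].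
  - by rewrite mul0r.
  - by rewrite mulrDl Bp ?Bq ?addr0.
  - by rewrite -mulrA Bq ?mulr0.
have [|N stopN] := artQ B lB; first by move=> k q Bq x /incA/Bq.
exists N => k Nk; apply/seteqP; split=> x.
  have [X _ AN] := rA N; rewrite -AN => Akx y Xy; apply: injf.
  have : B N (f y).
    by move=> z; rewrite -AN => /(_ y Xy) yz; rewrite -rmorphM yz rmorph0.
  by rewrite -(stopN k Nk) rmorphM rmorph0; apply.
by move: Nk => /subnK <-; elim: (k - N)%N => // d IHd /IHd/incA.
Qed.

(** * From the ring to the ring of fractions *)

(** A nonzero left ideal [A] inside [Q U] meets [U], hence absorbs every
element of [U] up to a regular factor, which is invertible in [Q]. *)
Lemma simple_ext U :
  essential_regular R -> uniform_left_ideal U -> simple_left_ideal (ext U).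
Proof.
move=> erR uU; have [lU U0 _] := uU; have lxU := left_ideal_ext lU.
split=> //.
  have /(neq_set0P lU)[x Ux x0] := U0; apply/(neq_set0P lxU).
  by exists (f x); [apply: ext_mem | apply: frac_neq0].
move=> A lA AU; have [A0|A0] := pselect (A = [set 0]); [by left | right].
apply/seteqP; split=> // q [c [u [rc Uu cq]]].
have lfA := left_ideal_contract lA.
have /(neq_set0P lA)[p Ap p0] : A != [set 0] by apply/eqP.
have [x [Ax Ux] x0] := ext_meet lfA lU (ext_contract lA Ap) (AU _ Ap) p0.
have meet : exists2 x, (f @^-1` A) x /\ U x & x != 0 by exists x.
have [d Adu rd] := erR _ (uniform_meet_preim_essential uU lfA meet Uu).
apply: (frac_ideal_cancel lA rc); rewrite cq.
by apply: (frac_ideal_cancel lA rd); rewrite -rmorphM.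
Qed.

Lemma essential_regular_semisimple_artinian :
  finite_left_udim R -> essential_regular R -> semisimple_artinian Q.
Proof.
move=> [n [U [uU _ eU]]] erR.
have sxU i := simple_ext erR (uU i).
apply: (simple_sum_semisimple_artinian sxU).
have lxU i : left_ideal (ext (U i)) by apply: simple_left_ideal_ideal.
have [c [a Ua ca] rc] := erR _ eU.
apply: (frac_ideal_cancel _ rc); first exact: left_ideal_ideal_sum.
rewrite mulr1 ca; exists (fun i => f (a i)) => [i|]; first exact: ext_mem.
by rewrite rmorph_sum.
Qed.

End Extension.

(** * Consequences of having regular elements in essential left ideals *)

Section EssentialRegular.
Variable R : pzRingType.
Hypothesis erR : essential_regular R.
Implicit Types (I U : set R) (x y : R).

(** The right annihilator of a nilpotent two-sided ideal [I] is an essential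
left ideal: given [x != 0], multiply it on the left by elements of [I] as
long as the product is nonzero. *)
Lemma essential_regular_semiprime : semiprime R.
Proof.
move=> I [lI Ir] [n nilI].
pose W := [set x | forall y, I y -> y * x = 0].
have lW : left_ideal W.
  apply/left_idealP; split=> [y _|x y Wx Wy z Iz|r x Wx z Iz].
  - by rewrite mulr0.
  - by rewrite mulrDr Wx ?Wy ?addr0.
  - by rewrite mulrA Wx //; apply: Ir.
have eW : essential_left_ideal W.
  apply/essentialP => // x x0.
  have : forall a : 'I_n -> R, (forall i, I (a i)) -> \prod_(i < n) a i * x = 0.
    by move=> a Ia; rewrite nilI ?mul0r.
  elim: n x x0 {nilI} => [|n IHn] x x0 nilx.
    have : \prod_(i < 0) (0 : R) * x = 0 by apply: nilx; case.
    by rewrite big_ord0 mul1r => /eqP; rewrite (negPf x0).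
  have [Wx|nWx] := pselect (W x); first by exists 1; rewrite mul1r.
  have [y Iy yx0] : exists2 y, I y & y * x != 0.
    apply: contrapT => ny; apply: nWx => y Iy; apply: contrapT => /eqP yx.
    by apply: ny; exists y.
  have [|r [Wr r0]] := IHn _ yx0; last by exists (r * y); rewrite -mulrA.
  move=> a Ia; pose b i := if unlift ord_max i is Some j then a j else y.
  have Ib i : I (b i) by rewrite /b; case: unliftP.
  have bmax : b ord_max = y by rewrite /b unlift_none.
  have := nilx b Ib; rewrite big_ord_recr /= bmax -mulrA => <-.
  congr (_ * _); apply: eq_bigr => i _; rewrite /b.
  have -> : widen_ord (leqnSn n) i = lift ord_max i.
    by apply: val_inj; rewrite /= /bump leqNgt ltn_ord.
  by rewrite liftK.
have [c Wc [rc _]] := erR eW.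
apply/seteqP; split=> [x Ix|_ ->]; last exact: left_ideal0.
by apply: rc; apply: Wc.
Qed.

(** Since [R] is semiprime, [U u != 0] for some [u] in [U]. If [x u = 0] for
some nonzero [x] in [U], then any [y] in [U] satisfies [c y u = 0] for a regular
[c], so that [U u = 0]. *)
Lemma essential_regular_uniform U :
  uniform_left_ideal U -> left_regular_in U !=set0.
Proof.
move=> uU; have [lU U0 _] := uU; apply: contrapT => nreg.
have /(neq_set0P lU)[x Ux /eqP[]] := U0.
apply: (semiprime_left_ideal essential_regular_semiprime lU _ Ux).
move=> y u Uy Uu; apply: contrapT => yu0; apply: nreg; exists u; split=> //.
move=> a b; rewrite !inE => Ua Ub /= ab; apply: contrapT => anb; apply: yu0.
have meet : exists2 z, [set z | z * u = 0] z /\ U z & z != 0.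
  exists (a - b); last by rewrite subr_eq0; apply/eqP.
  by split; [rewrite /= mulrBl ab subrr | apply: left_idealB].
have [c /= cyu [_ rc]] := erR (uniform_meet_preim_essential uU
  (left_ideal_lann u) meet Uy).
by apply: rc; rewrite mulrA.
Qed.

End EssentialRegular.

(** * The equivalence *)

Theorem theorem1p2 (R : pzRingType) :
  [<-> has_semisimple_artinian_left_quotient_ring R;
       [/\ semiprime R, finite_left_udim R,
           acc_on (right_annihilators R) &
           forall U : set R, uniform_left_ideal U -> left_regular_in U !=set0];
       [/\ semiprime R, finite_left_udim R,
           acc_on [set ker_lmul c | c in left_regular R] &
           forall U : set R, uniform_left_ideal U -> left_regular_in U !=set0];
       [/\ semiprime R, finite_left_udim R,
           acc_on [set ker_lmul r | r in [set: R]] &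
           forall U : set R, uniform_left_ideal U -> left_regular_in U !=set0]].
Proof.
have step12 : has_semisimple_artinian_left_quotient_ring R ->
    [/\ semiprime R, finite_left_udim R, acc_on (right_annihilators R) &
        forall U : set R, uniform_left_ideal U -> left_regular_in U !=set0].
  move=> [Q [f [frac [ssQ artQ]]]].
  have erR := semisimple_essential_regular frac ssQ.
  split; last exact: essential_regular_uniform.
  - exact: essential_regular_semiprime.
  - exact: semisimple_finite_left_udim frac ssQ.
  - exact: left_artinian_acc_right_annihilators frac artQ.
have accS (F G : set (set R)) : F `<=` G -> acc_on G -> acc_on F.
  by move=> FG accG A FA; apply: accG => k; apply/FG/FA.
have ker_ann : [set ker_lmul r | r in [set: R]] `<=` right_annihilators R.
  move=> _ [r _ <-]; exists [set r]; first by exists r.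
  by apply/seteqP; split=> x /=; [apply | move=> rx _ ->].
have lker : [set ker_lmul c | c in left_regular R] `<=`
    [set ker_lmul r | r in [set: R]].
  by move=> _ [c _ <-]; exists c.
have step31 : [/\ semiprime R, finite_left_udim R,
      acc_on [set ker_lmul c | c in left_regular R] &
      forall U : set R, uniform_left_ideal U -> left_regular_in U !=set0] ->
    has_semisimple_artinian_left_quotient_ring R.
  move=> [spR fdR accR regU].
  have erR : essential_regular R.
    move=> I eI; have [c Ic rc] := essential_left_regular fdR regU eI.
    by exists c => //; apply: left_regular_regular.
  have [Q [f frac]] := exists_classical_left_quotient_ring
    (essential_regular_left_ore fdR erR).
  exists Q, f; split=> //.
  exact: essential_regular_semisimple_artinian frac fdR erR.
have acc_kerl : acc_on (right_annihilators R) ->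
    acc_on [set ker_lmul c | c in left_regular R].
  by apply: accS; apply: subset_trans lker ker_ann.
tfae=> [//|[? ? ? ?]|/step31/step12[? ? accR ?]|[? ? accR ?]].
- by split=> //; apply: acc_kerl.
- by split=> //; apply: accS accR.
- by apply: step31; split=> //; apply: accS accR.
Qed.
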